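(* Let $0<\beta<1$ and let $A_T$, $\bar K$, $\hat K$ be as defined in the context. Then there is $T_0$ such that for all $T\ge T_0$ the following hold. (a) $$\sqrt{\hat K\beta}\cos\left(\tfrac{\pi}{T}\right)+\sqrt{\left(\hat K\cos^2\left(\tfrac{\pi}{T}\right)-\bar K\right)\beta}\;\le\;\sqrt{\rho(A_T)}\;\le\;\sqrt{\hat K\beta}\cos\left(\tfrac{\pi}{2T-1}\right)+\sqrt{\left(\hat K\cos^2\left(\tfrac{\pi}{2T-1}\right)-\bar K\right)\beta}.$$ Moreover, there is $\theta_T\in(0,2\pi)$ with $\rho(A_T)=-\bar K\beta+2\sqrt{\rho(A_T)\beta\hat K}\cos(\theta_T)$, and any such $\theta_T$ satisfies $\cos\left(\frac{\pi}{T}\right)\le\cos(\theta_T)\le\cos\left(\frac{\pi}{2T-1}\right)$. (b) With $\theta_T$ as in (a), the right Perron eigenvectors of $A_T$ (the eigenvectors for the eigenvalue $\rho(A_T)$) are, up to a scalar multiple, $v=(v_1,\dots,v_{T-1})$ with $$v_j=\left(\sqrt{\frac{\hat K}{\rho(A_T)\beta}}\right)^{j}\sin(j\theta_T).$$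
   Context: Let $0<\beta<1$, $\rho>0$, and $L_1,K_1>0$ with $\beta K_1<2$. (In the source, $L_1,K_1$ are Lipschitz constants of the cost and transition kernel of a finite-state mean-field game and $\rho$ is the strong convexity constant of a regularizer; only these numbers enter here.) Put $\bar L=\frac{L_1}{1-\beta K_1/2}$, $\bar K=\frac{3K_1}{2}+\frac{K_1\bar L}{2\rho(1-\beta)}$, $\hat K=\bar K+\frac{K_1\bar L}{\rho}$. For $T\ge2$, $A_T=(a_{ij})_{i,j=1}^{T-1}$ is the $(T-1)\times(T-1)$ matrix with $a_{ij}=\frac{\bar LK_1}{\rho}\beta^{\,j-i+1}$ for $j\ge i$, $a_{i,i-1}=\hat K$, and $a_{ij}=0$ for $j<i-1$. $\rho(A_T)$ denotes the spectral radius of $A_T$ (which is a positive simple eigenvalue), while $\rho$ alone is the constant above. *)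

(* Defs.v *)
From HB Require Import structures.
From mathcomp Require Import all_boot all_order all_algebra.
From mathcomp Require Import complex.
From mathcomp Require Import classical_sets reals trigo.

Set Implicit Arguments.
Unset Strict Implicit.
Unset Printing Implicit Defensive.

Import Order.TTheory GRing.Theory Num.Theory.
Local Open Scope ring_scope.

(* The set of moduli is finite, and nonempty as soon as 0 < n, so the supremum
   is a maximum over all complex eigenvalues (for n = 0 it is 0). *)
Definition spectral_radius (R : realType) (n : nat) (A : 'M[R]_n) : R :=
  sup [set Normc.normc z | z in
         [set z : R[i] | eigenvalue (map_mx (real_complex R) A) z]]%classic.

Definition Lbar (R : realType) (beta L1 K1 : R) : R :=
  L1 / (1 - beta * K1 / 2).

Definition Kbar (R : realType) (beta rho L1 K1 : R) : R :=
  3 * K1 / 2 + K1 * Lbar beta L1 K1 / (2 * rho * (1 - beta)).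

Definition Khat (R : realType) (beta rho L1 K1 : R) : R :=
  Kbar beta rho L1 K1 + K1 * Lbar beta L1 K1 / rho.

(* Indices are shifted: the ordinal i stands for the row (column) i + 1 of the
   1-based description; the exponent j - i + 1 and the conditions j >= i,
   j = i - 1 are invariant under this shift. *)
Definition A_mx (R : realType) (beta rho L1 K1 : R) (T : nat) : 'M[R]_(T.-1) :=
  \matrix_(i, j)
    if (i <= j)%N then Lbar beta L1 K1 * K1 / rho * beta ^+ (j - i + 1)
    else if (i == j.+1 :> nat) then Khat beta rho L1 K1
    else 0.

Definition rho_A (R : realType) (beta rho L1 K1 : R) (T : nat) : R :=
  spectral_radius (A_mx beta rho L1 K1 T).

(* Num.sqrt vanishes on negative arguments; since Kbar < Khat, the second
   radicand is positive once cos x is close enough to 1. *)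
Definition sqrt_bound (R : realType) (beta rho L1 K1 x : R) : R :=
  Num.sqrt (Khat beta rho L1 K1 * beta) * cos x
  + Num.sqrt ((Khat beta rho L1 K1 * cos x ^+ 2 - Kbar beta rho L1 K1) * beta).

Definition is_theta (R : realType) (beta rho L1 K1 : R) (T : nat) (theta : R) :=
  [/\ 0 < theta, theta < 2 * pi &
      rho_A beta rho L1 K1 T
      = - (Kbar beta rho L1 K1 * beta)
        + 2 * Num.sqrt (rho_A beta rho L1 K1 T * beta * Khat beta rho L1 K1)
            * cos theta].

(* The entry at the ordinal j is v_(j+1). *)
Definition perron_vec (R : realType) (beta rho L1 K1 : R) (T : nat) (theta : R)
  : 'cV[R]_(T.-1) :=
  \col_j (Num.sqrt (Khat beta rho L1 K1 / (rho_A beta rho L1 K1 T * beta))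
            ^+ j.+1 * sin (j.+1%:R * theta)).

(* Main.v *)
(* Row i minus beta times row i + 1 of A_T w = lambda w is the constant
   coefficient recurrence beta lambda w_(i+1) - (lambda + Kbar beta) w_i
   + Khat w_(i-1) = 0.  With lambda + Kbar beta = 2 sqrt(lambda beta Khat) cos x
   it is solved by w_j = r^j sin(j x), r = sqrt(Khat / (lambda beta)), and the
   last row becomes sqrt(lambda) sin(T x) = sqrt(Khat beta) sin((T - 1) x).
   Taking for sqrt(lambda) the larger root sqrt_bound x of the quadratic
   relation with cos x, the intermediate value theorem gives a solution x
   between pi / (2 T - 1) and pi / T.  There w is entrywise positive, so lambda
   is the spectral radius, and the bounds follow since sqrt_bound x increases
   with cos x. *)
Require Import Defs.
From HB Require Import structures.
From mathcomp Require Import all_boot all_order all_algebra.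
From mathcomp Require Import complex.
From mathcomp Require Import classical_sets reals trigo.
From mathcomp Require Import topology normedtype realfun ring lra zify.
Import Order.TTheory GRing.Theory Num.Theory.
Import numFieldNormedType.Exports.

Set Implicit Arguments.
Unset Strict Implicit.
Unset Printing Implicit Defensive.

Local Open Scope ring_scope.

(** * Positive eigenvectors and the spectral radius *)

(** [eigenvalue] speaks of row vectors; a column killed by A - a makes that square matrix singular,
    so its left kernel is nonzero too. *)
Lemma eigenvalue_of_col (F : fieldType) (n : nat) (A : 'M[F]_n) (w : 'cV[F]_n)
    (a : F) : w != 0 -> A *m w = a *: w -> eigenvalue A a.
Proof.
move=> w0 Aw; rewrite /eigenvalue /eigenspace kermx_eq0 row_free_unit.
apply: contra w0 => uA; rewrite -[w](mulKmx uA) mulmxBl Aw mul_scalar_mx.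
by rewrite subrr mulmx0.
Qed.

(* Pairing |v| for a left eigenvector v with the positive right eigenvector w
   bounds the modulus of every eigenvalue by lambda. *)
Lemma spectral_radius_pos_eigenvector (R : realType) (n : nat) (A : 'M[R]_n)
    (w : 'cV[R]_n) (lambda : R) :
  (0 < n)%N -> (forall i j, 0 <= A i j) -> (forall i, 0 < w i 0) ->
  A *m w = lambda *: w -> spectral_radius A = lambda.
Proof.
move=> n_gt0 A_ge0 w_gt0 Aw.
have lambda_ge0 : 0 <= lambda.
  have /(congr1 (fun u : 'cV_n => u (Ordinal n_gt0) 0)) := Aw.
  rewrite !mxE => Ai; rewrite -(pmulr_lge0 _ (w_gt0 (Ordinal n_gt0))) -Ai.
  by apply: sumr_ge0 => j _; rewrite mulr_ge0 // ltW.
pose f : {rmorphism R -> R[i]} := real_complex R.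
have fw_ge0 i : 0 <= f (w i 0) by rewrite lecR ltW.
have lam_in : [set Normc.normc z | z in
    [set z : R[i] | eigenvalue (map_mx f A) z]]%classic lambda.
  exists (f lambda); last first.
    by rewrite /f /= expr0n addr0 sqrtr_sqr ger0_norm.
  apply: (@eigenvalue_of_col _ _ _ (map_mx f w)).
    apply/eqP => /(congr1 (fun u : 'cV_n => u (Ordinal n_gt0) 0)).
    rewrite !mxE => /eqP; rewrite fmorph_eq0 => /eqP w0.
    by have := w_gt0 (Ordinal n_gt0); rewrite w0 ltxx.
  by rewrite -map_mxM Aw map_mxZ.
have ub : ubound [set Normc.normc z | z in
    [set z : R[i] | eigenvalue (map_mx f A) z]]%classic lambda.
  move=> _ [z /eigenvalueP [v vA v0] <-].
  pose s := \sum_j `|v 0 j| * f (w j 0).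
  have s_gt0 : 0 < s.
    have [j vj] : exists j, v 0 j != 0 by apply/rV0Pn.
    rewrite /s (bigD1 j) //= ltr_pwDl //.
      by rewrite mulr_gt0 ?normr_gt0 // ltcR.
    by apply: sumr_ge0 => k _; rewrite mulr_ge0 ?fw_ge0.
  (* The norm of [R[i]] takes real values, so this inequality in the partial order of [R[i]]
     compares moduli in R once s is cancelled. *)
  suff : `|z| * s <= f lambda * s.
    by rewrite ler_pM2r // normc_def lecR; case: (z).
  have -> : `|z| * s = \sum_j `|(z *: v) 0 j| * f (w j 0).
    by rewrite mulr_sumr; apply: eq_bigr => j _; rewrite mxE normrM mulrA.
  have -> : f lambda * s
      = \sum_j \sum_i `|v 0 i| * f (A i j) * f (w j 0).
    rewrite exchange_big /= mulr_sumr; apply: eq_bigr => i _.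
    have /(congr1 (fun u : 'cV_n => f (u i 0))) := Aw.
    rewrite !mxE rmorphM rmorph_sum mulrCA => <-; rewrite mulr_sumr.
    by apply: eq_bigr => j _; rewrite rmorphM mulrA.
  apply: ler_sum => j _; rewrite -mulr_suml ler_wpM2r // -vA mxE.
  apply: le_trans (ler_norm_sum _ _ _) _; apply: ler_sum => i _.
  by rewrite mxE normrM (@ger0_norm _ (f _)) ?lecR.
apply/le_anti/andP; split.
  by apply: ge_sup => //; exists lambda.
by apply: ub_le_sup => //; exists lambda.
Qed.

(** * Eigenvectors of the matrix and the recurrence *)

(** The first row has no subdiagonal entry; the convention q 0 = 0 lets one formula cover all
    rows. *)
Lemma A_mx_mulE (R : realType) (beta rho L1 K1 : R) (T : nat) (q : nat -> R)
    (i : 'I_(T.-1)) : q 0%N = 0 ->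
  (A_mx beta rho L1 K1 T *m \col_j q j.+1) i 0
  = (\sum_(i <= j < T.-1)
       Lbar beta L1 K1 * K1 / rho * beta ^+ (j - i + 1) * q j.+1)
    + Khat beta rho L1 K1 * q i.
Proof.
move=> q0; rewrite mxE big_geq_mkord [X in _ = X + _]big_mkcond /=.
have -> : Khat beta rho L1 K1 * q i
    = \sum_(j < T.-1) if i == j.+1 :> nat then Khat beta rho L1 K1 * q i else 0.
  rewrite -big_mkcond /=; case ei: (i : nat) => [|k].
    by rewrite q0 mulr0 big1.
  have kT : (k < T.-1)%N by rewrite (ltn_trans (ltnSn k)) // -ei.
  by rewrite (big_pred1 (Ordinal kT)) // => j /=; rewrite eqSS eq_sym.
rewrite -big_split /=; apply: eq_bigr => j _; rewrite !mxE.
case: leqP => [ij|ji].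
  by rewrite ltn_eqF ?addr0 // ltnS.
by rewrite add0r; case: eqP => [->|]; rewrite ?mul0r.
Qed.

Lemma A_mx_eigenvector_of_recurrence (R : realType) (beta rho L1 K1 lambda : R)
    (T : nat) (q : nat -> R) :
  (0 < T)%N -> q 0%N = 0 ->
  (forall i, beta * lambda * q i.+2
             - (lambda + Kbar beta rho L1 K1 * beta) * q i.+1
             + Khat beta rho L1 K1 * q i = 0) ->
  lambda * q T = Khat beta rho L1 K1 * q T.-1 ->
  A_mx beta rho L1 K1 T *m (\col_j q j.+1) = lambda *: \col_j q j.+1.
Proof.
move=> T_gt0 q0 rec bnd; apply/colP => i; rewrite A_mx_mulE // !mxE.
set c := Lbar beta L1 K1 * K1 / rho.
(* Induction from the last row upwards. The base case is an empty sum, which is the boundary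
   condition with q T lying one past the last entry; the recurrence is the induction step. *)
suff tail d m : (m + d)%N = T.-1 ->
    \sum_(m <= j < T.-1) c * beta ^+ (j - m + 1) * q j.+1
    = lambda * q m.+1 - Khat beta rho L1 K1 * q m.
  by rewrite (tail (T.-1 - i)%N) ?subrK // subnKC // ltnW.
elim: d m => [|d IHd] m mT.
  by rewrite -mT addn0 big_geq // -[m]addn0 mT prednK // bnd subrr.
have mlt : (m < T.-1)%N by rewrite -mT addnS ltnS leq_addr.
rewrite big_ltn // subnn add0n expr1.
have -> : \sum_(m.+1 <= j < T.-1) c * beta ^+ (j - m + 1) * q j.+1
    = beta * \sum_(m.+1 <= j < T.-1) c * beta ^+ (j - m.+1 + 1) * q j.+1.
  rewrite mulr_sumr !big_nat; apply: eq_bigr => j /andP[mj _].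
  have -> : (j - m + 1)%N = (j - m.+1 + 1).+1 by lia.
  by rewrite exprS; ring.
rewrite IHd; last by rewrite addSnnS.
have KhatE : Khat beta rho L1 K1 = Kbar beta rho L1 K1 + c.
  by rewrite /Khat /c [K1 * _]mulrC.
have := rec m; move: (q m.+2) (q m.+1) (q m) => q2 q1 q00; rewrite KhatE => e.
by apply/eqP; rewrite -subr_eq0; apply/eqP; rewrite -[RHS]e; ring.
Qed.

(* Row i + 1 expresses Khat * w_i through the later entries. *)
Lemma A_mx_eigenvector_eq0 (R : realType) (beta rho L1 K1 lambda : R) (n : nat)
    (w : 'cV[R]_n.+1) :
  Khat beta rho L1 K1 != 0 ->
  A_mx beta rho L1 K1 n.+2 *m w = lambda *: w -> w ord_max 0 = 0 -> w = 0.
Proof.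
move=> H0 Aw wn.
suff w0 d (i : 'I_n.+1) : (n - i <= d)%N -> w i 0 = 0.
  by apply/colP => i; rewrite mxE (w0 n) // leq_subr.
elim: d i => [|d IHd] i id.
  by rewrite (_ : i = ord_max) //; apply/val_inj => /=; have := ltn_ord i; lia.
have [->//|i_neq] := eqVneq i ord_max.
have iS : (i.+1 < n.+1)%N.
  by rewrite ltnS ltn_neqAle -ltnS ltn_ord andbT; apply: contra i_neq.
have /(congr1 (fun u : 'cV_n.+1 => u (Ordinal iS) 0)) := Aw.
rewrite !mxE [w (Ordinal iS) 0]IHd ?mulr0 /=; last by lia.
rewrite (bigD1 i) //= big1 ?addr0 => [|j ji].
  by rewrite !mxE /= ltnn eqxx => /eqP; rewrite mulf_eq0 (negPf H0) => /eqP.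
rewrite !mxE /=; case: ltnP => [ij|ij]; first by rewrite IHd ?mulr0 //; lia.
by rewrite eqSS eq_sym (_ : (j == i :> nat) = false) ?mul0r //; apply/negbTE.
Qed.

(** * Signs of the constants and the function [sqrt_bound] *)

Lemma Lbar_gt0 (R : realType) (beta L1 K1 : R) :
  0 < L1 -> beta * K1 < 2 -> 0 < Lbar beta L1 K1.
Proof. by move=> L1_gt0 bK; rewrite divr_gt0 //; lra. Qed.

Lemma Kbar_gt0 (R : realType) (beta rho L1 K1 : R) :
  beta < 1 -> 0 < rho -> 0 < L1 -> 0 < K1 -> beta * K1 < 2 ->
  0 < Kbar beta rho L1 K1.
Proof.
move=> b1 rho_gt0 L1_gt0 K1_gt0 /(Lbar_gt0 L1_gt0).
rewrite /Kbar; move: (Lbar _ _ _) => L L_gt0.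
rewrite addr_gt0 //; first by rewrite divr_gt0 // mulr_gt0.
by rewrite divr_gt0 ?mulr_gt0 // subr_gt0.
Qed.

Lemma ltr_Kbar_Khat (R : realType) (beta rho L1 K1 : R) :
  0 < rho -> 0 < L1 -> 0 < K1 -> beta * K1 < 2 ->
  Kbar beta rho L1 K1 < Khat beta rho L1 K1.
Proof.
move=> rho_gt0 L1_gt0 K1_gt0 /(Lbar_gt0 L1_gt0).
rewrite /Khat; move: (Lbar _ _ _) => L L_gt0.
by rewrite ltrDl divr_gt0 ?mulr_gt0.
Qed.

(* With K < H, sqrt_bound x is the larger root s of
   s ^+ 2 - 2 * sqrt (H * beta) * cos x * s + K * beta; it exceeds
   sqrt (H * beta) because, by the last hypothesis, the polynomial is negative
   there. *)
Lemma sqrt_bound_root (R : realType) (beta rho L1 K1 x : R) :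
  let H := Khat beta rho L1 K1 in let K := Kbar beta rho L1 K1 in
  let s := sqrt_bound beta rho L1 K1 x in
  0 < H -> 0 < beta -> K + H < 2 * H * cos x ->
  Num.sqrt (H * beta) < s
  /\ s ^+ 2 = 2 * (s * Num.sqrt (H * beta)) * cos x - K * beta.
Proof.
rewrite /= /sqrt_bound; move: (Khat _ _ _ _) (Kbar _ _ _ _) => H K.
move: beta (cos x) (cos_le1 x) => b C C_le1 H_gt0 b_gt0 hC.
have S2 : Num.sqrt (H * b) ^+ 2 = H * b by rewrite sqr_sqrtr // ltW // mulr_gt0.
have S_ge0 := sqrtr_ge0 (H * b).
(* After cancelling H C^2 this is b times the hypothesis K + H < 2 H C. It also makes the radicand
   positive, so [Num.sqrt] is a genuine root there. *)
have lt_sq : H * b * (1 - C) ^+ 2 < (H * C ^+ 2 - K) * b by nra.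
have D2 : Num.sqrt ((H * C ^+ 2 - K) * b) ^+ 2 = (H * C ^+ 2 - K) * b.
  rewrite sqr_sqrtr // ltW //; apply: le_lt_trans lt_sq.
  by rewrite mulr_ge0 ?sqr_ge0 // ltW // mulr_gt0.
split; last by nra.
have : Num.sqrt (H * b) * (1 - C) < Num.sqrt ((H * C ^+ 2 - K) * b).
  rewrite -ltr_sqr ?nnegrE ?sqrtr_ge0 ?mulr_ge0 ?subr_ge0 //.
  by rewrite exprMn S2 D2.
by lra.
Qed.

Lemma ler_sqrt_bound (R : realType) (beta rho L1 K1 x y : R) :
  0 <= beta -> 0 <= Khat beta rho L1 K1 -> 0 <= cos x <= cos y ->
  sqrt_bound beta rho L1 K1 x <= sqrt_bound beta rho L1 K1 y.
Proof.
move=> b0 H0 /andP[cx0 cxy]; rewrite lerD ?ler_wpM2l ?sqrtr_ge0 //.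
rewrite ler_wsqrtr // ler_wpM2r // lerD2r ler_wpM2l //.
by rewrite ler_sqr ?nnegrE // (le_trans cx0).
Qed.

Lemma continuous_sqrt_bound (R : realType) (beta rho L1 K1 : R) :
  continuous (sqrt_bound beta rho L1 K1 : R -> R).
Proof.
move=> x; rewrite /sqrt_bound; apply: cvgD.
  by apply: cvgMr; exact: continuous_cos.
apply: (@continuous_comp _ _ _
  (fun y : R => (Khat beta rho L1 K1 * cos y ^+ 2 - Kbar beta rho L1 K1) * beta)
  Num.sqrt); last exact: sqrt_continuous.
apply: cvgMl; apply: cvgB; last exact: cvg_cst.
apply: cvgMr; apply: (@continuous_comp _ _ _ cos (fun y : R => y ^+ 2)).
  exact: continuous_cos.
exact: exprn_continuous.
Qed.

(** * Sine recurrence and existence of the angle *)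

Lemma sin_recurrence (R : realType) (x : R) (i : nat) :
  sin (i.+2%:R * x) = 2 * cos x * sin (i.+1%:R * x) - sin (i%:R * x).
Proof.
have -> : i.+2%:R * x = i.+1%:R * x + x by rewrite -[i.+2]addn1 natrD; ring.
have -> : i%:R * x = i.+1%:R * x - x by rewrite -[i.+1]addn1 natrD; ring.
by rewrite sinD sinB; ring.
Qed.

(** Source of the threshold on T: with a = (K + H) / (2 H) it gives the cosine condition of
    [sqrt_bound_root] at pi / T. *)
Lemma cos_near1 (R : realType) (a : R) : a < 1 ->
  exists T0 : nat, forall T : nat, (T0 <= T)%N -> a < cos (pi / T%:R).
Proof.
move=> a1; have : \forall x \near (0 : R), a < cos x.
  by apply: (cvgr_gt _ (@continuous_cos R 0)); rewrite cos0.
move=> /nbhs_ballP [e /= e0 ae].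
have pe : 0 <= pi / e :> R by rewrite divr_ge0 ?pi_ge0 // ltW.
exists (Num.truncn (pi / e)).+1 => T T0T; apply: ae.
have T_gt0 : (0 : R) < T%:R by rewrite ltr0n; lia.
rewrite /ball /= sub0r normrN ger0_norm ?divr_ge0 ?pi_ge0 ?ler0n //.
rewrite ltr_pdivrMr // mulrC -ltr_pdivrMr //.
by apply: lt_le_trans (truncnS_gt _) _; rewrite ler_nat.
Qed.

Lemma ler_cos_0pi (R : realType) (x y : R) :
  0 <= x -> x <= y -> y <= pi -> cos y <= cos x.
Proof.
move=> x0 xy ypi; have [->//|yx] := eqVneq x y; apply: ltW.
rewrite ltr_cos ?in_itv /= ?x0 ?ypi ?(le_trans x0) ?(le_trans xy) //.
by rewrite lt_neqAle yx.
Qed.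

(* At x = pi / (2 T - 1) the two sines agree and the larger coefficient
   sqrt_bound x wins; at x = pi / T the left-hand side vanishes. *)
Lemma exists_angle (R : realType) (beta rho L1 K1 : R) (T : nat) :
  let H := Khat beta rho L1 K1 in
  (2 <= T)%N -> 0 < H -> 0 < beta ->
  Kbar beta rho L1 K1 + H < 2 * H * cos (pi / T%:R) ->
  exists2 x : R, pi / (2 * T%:R - 1) <= x <= pi / T%:R &
    sqrt_bound beta rho L1 K1 x * sin (T%:R * x)
    = Num.sqrt (H * beta) * sin (T.-1%:R * x).
Proof.
move=> H T2 H_gt0 b_gt0 hcos.
have T2R : 2 <= T%:R :> R by rewrite ler_nat.
have T1E : T.-1%:R = T%:R - 1 :> R.
  by rewrite -[in RHS](@prednK T) ?(ltn_trans _ T2) // -natr1 addrK.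
have T_gt0 : 0 < T%:R :> R by lra.
have d_gt0 : 0 < 2 * T%:R - 1 :> R by lra.
have pi0 := pi_gt0 R.
set a := pi / (2 * T%:R - 1); set c := pi / T%:R.
have a_gt0 : 0 < a by rewrite divr_gt0.
have aE : (2 * T%:R - 1) * a = pi by rewrite mulrC divfK // gt_eqF.
have cE : T%:R * c = pi by rewrite mulrC divfK // gt_eqF.
have ac : a <= c by rewrite ler_pM2l // lef_pV2 ?posrE //; lra.
have c_lt : c < pi by rewrite -cE; have := divr_gt0 pi0 T_gt0; rewrite -/c; nra.
pose g x := sqrt_bound beta rho L1 K1 x * sin (T%:R * x)
            - Num.sqrt (H * beta) * sin (T.-1%:R * x).
have cont_sin (k : R) : continuous (fun x : R => sin (k * x)).
  move=> x; apply: (@continuous_comp _ _ _ (fun y : R => k * y) sin).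
    by apply: cvgMr; exact: cvg_id.
  exact: continuous_sin.
have g_cont : continuous g.
  move=> x; apply: cvgB; last by apply: cvgMr; exact: cont_sin.
  by apply: cvgM; [exact: continuous_sqrt_bound | exact: cont_sin].
have ga : 0 <= g a.
  (* The angles T a and (T - 1) a add up to pi. *)
  rewrite /g (_ : sin (T%:R * a) = sin (T.-1%:R * a)); last first.
    have -> : T.-1%:R * a = pi - T%:R * a by rewrite T1E -aE; ring.
    by rewrite sinB sinpi cospi; ring.
  rewrite -mulrBl mulr_ge0 //.
    rewrite subr_ge0 ltW //; apply: (sqrt_bound_root _ _ _).1 => //.
    apply: lt_le_trans hcos _; rewrite ler_pM2l ?mulr_gt0 //.
    by apply: ler_cos_0pi; rewrite // ltW.
  by rewrite ltW // sin_gt0_pi // T1E; nra.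
have gc : g c <= 0.
  rewrite /g cE sinpi mulr0 sub0r oppr_le0 mulr_ge0 ?sqrtr_ge0 //.
  have c_gt0 : 0 < c by rewrite divr_gt0.
  by rewrite ltW // sin_gt0_pi // T1E -cE; nra.
have [|x] := @IVT R g a c 0 ac (continuous_subspaceT g_cont).
  by rewrite ge_min gc orbT le_max ga.
by rewrite in_itv /= => xI /eqP; rewrite subr_eq0 => /eqP gx; exists x.
Qed.

(** * The Perron pair at the chosen angle *)

Lemma perron_eigenpair (R : realType) (beta rho L1 K1 x : R) (T : nat) :
  let H := Khat beta rho L1 K1 in
  let s := sqrt_bound beta rho L1 K1 x in
  (2 <= T)%N -> 0 < beta -> 0 < rho -> 0 < Lbar beta L1 K1 -> 0 < K1 -> 0 < H ->
  Kbar beta rho L1 K1 + H < 2 * H * cos x -> 0 < x -> T%:R * x <= pi ->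
  s * sin (T%:R * x) = Num.sqrt (H * beta) * sin (T.-1%:R * x) ->
  [/\ rho_A beta rho L1 K1 T = s ^+ 2,
      A_mx beta rho L1 K1 T *m perron_vec beta rho L1 K1 T x
      = rho_A beta rho L1 K1 T *: perron_vec beta rho L1 K1 T x &
      forall i, 0 < perron_vec beta rho L1 K1 T x i 0].
Proof.
move=> H s T2 b_gt0 rho_gt0 L_gt0 K1_gt0 H_gt0 hcos x_gt0 Tx bnd.
have [Ss s2] := sqrt_bound_root H_gt0 b_gt0 hcos.
rewrite -/s -/H in Ss s2; set S := Num.sqrt (H * beta) in Ss s2 bnd.
have S2 : S ^+ 2 = H * beta by rewrite sqr_sqrtr // ltW // mulr_gt0.
have S_gt0 : 0 < S by rewrite sqrtr_gt0 mulr_gt0.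
have s_gt0 : 0 < s := lt_trans S_gt0 Ss.
(* The ratio in [perron_vec], with s ^+ 2 standing for the spectral radius until [rhoE] identifies
   the two. *)
pose r := Num.sqrt (H / (s ^+ 2 * beta)).
have rE : r = S / (s * beta).
  rewrite /r (_ : H / _ = (S / (s * beta)) ^+ 2).
    by rewrite sqrtr_sqr ger0_norm // ltW // divr_gt0 // mulr_gt0.
  by rewrite expr_div_n S2; field; rewrite !gt_eqF.
have r_gt0 : 0 < r by rewrite rE divr_gt0 // mulr_gt0.
(* With this and [br2], all terms of the recurrence for q carry the common factor H r^i, and the
   sine recurrence cancels them. *)
have sSr : s * S * r = H.
  transitivity (S ^+ 2 / beta); last by rewrite S2 mulfK // gt_eqF.
  by rewrite rE; field; rewrite !gt_eqF.
have br2 : beta * s ^+ 2 * r ^+ 2 = H.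
  by rewrite rE expr_div_n S2; field; rewrite !gt_eqF.
pose q j := r ^+ j * sin (j%:R * x).
have q_eig :
    A_mx beta rho L1 K1 T *m (\col_j q j.+1) = s ^+ 2 *: \col_j q j.+1.
  apply: A_mx_eigenvector_of_recurrence; first exact: ltn_trans T2.
  - by rewrite /q mul0r sin0 mulr0.
  - move=> i; rewrite /q sin_recurrence -/H ![r ^+ _.+1]exprS.
    move: (sin (i.+1%:R * x)) (sin (i%:R * x)) => s1 s0.
    have -> : s ^+ 2 + Kbar beta rho L1 K1 * beta = 2 * (s * S) * cos x by lra.
    rewrite (_ : _ + _ = r ^+ i * ((beta * s ^+ 2 * r ^+ 2)
      * (2 * cos x * s1 - s0) - (s * S * r) * (2 * cos x * s1) + H * s0)); last by ring.
    by rewrite br2 sSr; ring.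
  - have rT : r ^+ T = r * r ^+ T.-1.
      by rewrite -exprS prednK // (ltn_trans _ T2).
    rewrite /q rT -/H.
    transitivity (r ^+ T.-1 * (s * r) * (s * sin (T%:R * x))); first by ring.
    transitivity (s * S * r * (r ^+ T.-1 * sin (T.-1%:R * x))).
      by rewrite bnd; ring.
    by rewrite sSr.
(* The indices run from 1 to T - 1, so every angle lies strictly between 0 and T x <= pi. *)
have q_gt0 i : 0 < (\col_(j < T.-1) q j.+1) i 0.
  rewrite mxE /q mulr_gt0 ?exprn_gt0 // sin_gt0_pi // mulr_gt0 ?ltr0n //=.
  by apply: lt_le_trans Tx; rewrite ltr_pM2r // ltr_nat; have := ltn_ord i; lia.
have rhoE : rho_A beta rho L1 K1 T = s ^+ 2.
  apply: (spectral_radius_pos_eigenvector _ _ q_gt0 q_eig).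
    by rewrite -subn1 subn_gt0.
  move=> i j; rewrite mxE; case: ifP => _.
    apply: mulr_ge0; last by rewrite exprn_ge0 // ltW.
    by rewrite divr_ge0 ?(ltW rho_gt0) // ltW // pmulr_rgt0.
  by case: ifP => _ //; exact: ltW.
have -> : perron_vec beta rho L1 K1 T x = \col_j q j.+1.
  by apply/colP => j; rewrite !mxE rhoE.
by rewrite rhoE.
Qed.

(** * Uniqueness of the cosine and of the Perron direction *)

(** On (0, 2 pi) the cosine fixes the angle only up to y -> 2 pi - y, and this reflection flips the
    sign of every sin(j y). *)
Lemma perron_vec_reflect (R : realType) (beta rho L1 K1 x y : R) (T : nat) :
  0 < x < pi -> 0 < y < 2 * pi -> cos y = cos x ->
  exists2 e : R, e != 0 &
    perron_vec beta rho L1 K1 T y = e *: perron_vec beta rho L1 K1 T x.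
Proof.
move=> /andP[x0 xpi] /andP[y0 y2pi] cyx; have [ypi|piy] := lerP y pi.
  exists 1; first exact: oner_neq0.
  by rewrite scale1r (@cos_inj R y x) // in_itv /= ltW // ltW.
have <- : 2 * pi - y = x.
  apply: cos_inj; rewrite ?in_itv /=; try lra.
  by rewrite -cyx cosB mulr_natl cos2pi sin2pi; ring.
exists (-1); first by rewrite oppr_eq0 oner_neq0.
apply/colP => j; rewrite !mxE mulrCA; congr (_ * _).
have -> : j.+1%:R * (2 * pi - y) = - (j.+1%:R * y) + (pi *+ 2) *+ j.+1.
  by rewrite -[_ *+ j.+1]mulr_natl -[pi *+ 2]mulr_natl; ring.
by rewrite (periodicn (@sinD2pi R)) sinN; ring.
Qed.

Theorem theorem2 (R : realType) (beta rho L1 K1 : R)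
  (hbeta0 : 0 < beta) (hbeta1 : beta < 1) (hrho : 0 < rho)
  (hL1 : 0 < L1) (hK1 : 0 < K1) (hbetaK1 : beta * K1 < 2) :
  exists T0 : nat, forall T : nat, (2 <= T)%N -> (T0 <= T)%N ->
    [/\ (* (a), bounds *)
        sqrt_bound beta rho L1 K1 (pi / T%:R)
          <= Num.sqrt (rho_A beta rho L1 K1 T)
          <= sqrt_bound beta rho L1 K1 (pi / (2 * T%:R - 1)),
        (* (a), the angle *)
        (exists theta : R, is_theta beta rho L1 K1 T theta),
        (forall theta : R, is_theta beta rho L1 K1 T theta ->
           cos (pi / T%:R) <= cos theta <= cos (pi / (2 * T%:R - 1))) &
        (* (b) *)
        (forall theta : R, is_theta beta rho L1 K1 T theta ->
           forall w : 'cV[R]_(T.-1),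
             (w != 0 /\
              A_mx beta rho L1 K1 T *m w = rho_A beta rho L1 K1 T *: w)
             <-> (exists2 c : R, c != 0 &
                    w = c *: perron_vec beta rho L1 K1 T theta))].
Proof.
have L_gt0 := Lbar_gt0 hL1 hbetaK1.
have K_gt0 := Kbar_gt0 hbeta1 hrho hL1 hK1 hbetaK1.
have KH := ltr_Kbar_Khat hrho hL1 hK1 hbetaK1.
set K := Kbar _ _ _ _ in K_gt0 KH; set H := Khat _ _ _ _ in KH.
have H_gt0 : 0 < H := lt_trans K_gt0 KH.
(* The bound (K + H) / (2 H) is below 1 because K < H. *)
have [|T0 hT0] := @cos_near1 R ((K + H) / (2 * H)).
  by rewrite ltr_pdivrMr ?mulr_gt0 //; lra.
exists T0 => T T2 T0T; have pi0 := pi_gt0 R.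
have hcosT : K + H < 2 * H * cos (pi / T%:R).
  by have := hT0 T T0T; rewrite ltr_pdivrMr ?mulr_gt0 // mulrC.
have T2R : 2 <= T%:R :> R by rewrite ler_nat.
have T_gt0 : 0 < T%:R :> R by lra.
have d_gt0 : 0 < 2 * T%:R - 1 :> R by lra.
have [x /andP[ax xc] xE] := exists_angle T2 H_gt0 hbeta0 hcosT.
have x_gt0 : 0 < x by apply: lt_le_trans ax; rewrite divr_gt0.
have Tx : T%:R * x <= pi by rewrite mulrC -ler_pdivlMr.
have x_pi : x < pi by apply: lt_le_trans Tx; rewrite ltr_pMl //; lra.
have c_le : cos (pi / T%:R) <= cos x.
  apply: ler_cos_0pi; rewrite ?(ltW x_gt0) // ler_pdivrMr // ler_peMr ?ltW //.
  lra.
have le_c : cos x <= cos (pi / (2 * T%:R - 1)).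
  by apply: ler_cos_0pi; rewrite ?(ltW x_pi) // ltW // divr_gt0.
have hcosx : K + H < 2 * H * cos x.
  by apply: lt_le_trans hcosT _; rewrite ler_pM2l // mulr_gt0.
have cT0 : 0 <= cos (pi / T%:R) :> R.
  have H2_gt0 : 0 < 2 * H by rewrite mulr_gt0.
  by rewrite ltW // -(pmulr_rgt0 _ H2_gt0) (lt_trans _ hcosT) // addr_gt0.
have [rhoE p_eig p_gt0] :=
  perron_eigenpair T2 hbeta0 hrho L_gt0 hK1 H_gt0 hcosx x_gt0 Tx xE.
have [Ss s2] := sqrt_bound_root H_gt0 hbeta0 hcosx.
rewrite -/H -/K in Ss s2.
set s := sqrt_bound beta rho L1 K1 x in rhoE Ss s2.
have S_gt0 : 0 < Num.sqrt (H * beta) by rewrite sqrtr_gt0 mulr_gt0.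
have s_gt0 : 0 < s := lt_trans S_gt0 Ss.
have sqrt_rho : Num.sqrt (rho_A beta rho L1 K1 T) = s.
  by rewrite rhoE sqrtr_sqr gtr0_norm.
have sqrt_prod : Num.sqrt (rho_A beta rho L1 K1 T * beta * H)
    = s * Num.sqrt (H * beta).
  by rewrite -mulrA [beta * H]mulrC sqrtrM ?sqrt_rho // rhoE sqr_ge0.
(* The defining relation is linear in cos theta with the positive coefficient 2 s sqrt(H beta), so
   it determines cos theta. *)
have theta_cos theta : is_theta beta rho L1 K1 T theta -> cos theta = cos x.
  case=> _ _; rewrite -/K -/H sqrt_prod rhoE s2 => e.
  apply: (@mulfI _ (2 * (s * Num.sqrt (H * beta)))).
    by rewrite gt_eqF // !mulr_gt0.
  by move: e; lra.
have x_theta : is_theta beta rho L1 K1 T x.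
  split=> //; first by lra.
  by rewrite -/K -/H sqrt_prod rhoE s2; ring.
split; last 1 first.
- move=> theta th w; have [th0 th2pi _] := th.
  have [|||e e0 ->] := @perron_vec_reflect R beta rho L1 K1 x theta T.
  + by rewrite x_gt0.
  + by rewrite th0.
  + exact: theta_cos.
  set p := perron_vec _ _ _ _ _ _ in p_eig p_gt0 *.
  (* Writing T as n + 2 gives the matrix size n + 1, so that [ord0] and [ord_max] exist. *)
  case: T T2 {T0T hcosT T2R T_gt0 d_gt0 ax xc xE Tx c_le le_c cT0 sqrt_rho
           sqrt_prod theta_cos x_theta th} w p p_eig p_gt0 rhoE
    => [|[|n]] // _ w p p_eig p_gt0 rhoE.
  split=> [[w0 w_eig]|[c c0 ->]]; last first.
    split; last by rewrite !scalerA -scalemxAr p_eig !scalerA mulrC.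
    rewrite !scaler_eq0 (negPf c0) (negPf e0) /=.
    apply/eqP => pE; by have := p_gt0 ord0; rewrite pE mxE ltxx.
  have pn := gt_eqF (p_gt0 ord_max).
  (* This choice makes the last entry of w - c p vanish, so the eigenvector equation forces w = c
     p. *)
  pose c := w ord_max 0 / p ord_max 0.
  have wE : w = c *: p.
    apply/eqP; rewrite -subr_eq0; apply/eqP.
    apply: (@A_mx_eigenvector_eq0 R beta rho L1 K1 (rho_A beta rho L1 K1 n.+2)).
    - by rewrite gt_eqF.
    - by rewrite mulmxBr w_eig -scalemxAr p_eig scalerBr !scalerA mulrC.
    - by rewrite !mxE divfK ?subrr // pn.
  exists (c / e); last by rewrite scalerA divfK.
  rewrite mulf_neq0 ?invr_eq0 //; apply: contra w0 => /eqP c0.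
  by rewrite wE c0 scale0r.
- by rewrite sqrt_rho !ler_sqrt_bound ?(ltW hbeta0) ?(ltW H_gt0) // ?cT0
     ?(le_trans cT0).
- by exists x.
- by move=> theta /theta_cos ->; rewrite c_le.
Qed.
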